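(* Let each of $X_1,X_2$ be a q-space or a noncompact q-space. Let $Y$ be locally compact, let $\{T_i:Y\to X_1\}$ be a finite collection of proper continuous maps, and let $f:X_1\to X_2$ be a proper solid variable. (i) For an odd number of maps $T_i$, $i=1,\dots,2n-1$, where $X_1,X_2\subseteq\mathbb{R}$ (so that order statistics are defined), the inverse of the sample median is equivariant under $f$, i.e. $T_{(n)}^{-1}\circ f^{-1}=(f\circ T)_{(n)}^{-1}$, where $(f\circ T)_{(n)}$ is the $n$th order statistic of $\{f\circ T_i\}_{i=1}^{2n-1}$. (ii) Let $P$ be a deficient topological measure on $Y$. Then the generalized distribution of the sample median (for an odd or even number of maps) is equivariant under $f$, i.e. $\mu_{\{f\circ T_i\}}=\mu_{\{T_i\}}\circ f^{-1}$.
   Context: All spaces are Hausdorff. $\mathscr{O}(X),\mathscr{C}(X),\mathscr{K}(X)$ denote the open, closed, compact subsets of $X$; $\sqcup$ is disjoint union; a set is precompact if its closure is compact; a map is proper if preimages of compact sets are compact. Solid sets ($\emptyset$ counts as connected): if $X$ is compact, $A$ is solid if $A$ and $X\setminus A$ are connected; if $X$ is locally compact noncompact, $A$ is solid if $A$ is connected and no connected component of $X\setminus A$ is precompact. $\mathscr{A}_s^*(X)$: the sets that are compact solid or precompact open solid. A compact space has genus $0$ if it is not a disjoint union of more than two nonempty solid sets each open or closed. A q-space is a compact Hausdorff connected locally connected space of genus $0$; a noncompact q-space is a noncompact locally compact Hausdorff connected locally connected space whose one-point compactification has genus $0$. A solid variable is a continuous $f:X_1\to X_2$ such that $f^{-1}(A)$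 is solid in $X_1$ for every solid $A\subseteq X_2$ that is open or closed. A deficient topological measure on $Y$ is a map $\mu:\mathscr{C}(Y)\cup\mathscr{O}(Y)\to[0,\infty]$, not identically $\infty$, with $\mu(A\sqcup B)=\mu(A)+\mu(B)$ for disjoint compact $A,B$; $\mu(U)=\sup\{\mu(K):K\in\mathscr{K}(Y),K\subseteq U\}$ for open $U$; $\mu(F)=\inf\{\mu(U):U\in\mathscr{O}(Y),F\subseteq U\}$ for closed $F$. For an odd number of proper continuous maps $T_1,\dots,T_{2n-1}:Y\to X$, $X$ a (noncompact) q-space, the map $q_{\{T_i\}}(A)=\bigcup_{S\subseteq\{1,\dots,2n-1\},|S|\ge n}\bigcap_{i\in S}T_i^{-1}(A)$, $A\in\mathscr{A}_s^*(X)$, extends uniquely to an image transformation from $X$ to $Y$, i.e. a map $q:\mathscr{O}(X)\cup\mathscr{K}(X)\to\mathscr{O}(Y)\cup\mathscr{K}(Y)$ taking open sets to open and compact sets to compact sets, with $q(U)=\bigcup\{q(K):K\subseteq U,K\in\mathscr{K}(X)\}$ for open $U$, $q(K)=\bigcap\{q(U):K\subseteq U,U\in\mathscr{O}(X)\}$ for compact $K$, and $q(A\sqcup B)=q(A)\sqcup q(B)$ whenever $A,B,A\sqcup B\in\mathscr{O}(X)\cup\mathscr{K}(X)$. The generalized distribution of the sample median (g.d.s.m.) is $\mu_{\{T_i\}}=P\circ q_{\{T_i\}}$ on $\mathscr{O}(X)\cup\mathscr{K}(X)$; on $\mathscr{A}_s^*(X)$ it equals $P(\{y:|\{i:T_i(y)\in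 A\}|\ge n\})$. For an even number $2n$ of maps, $\mu_{\{T_i\}}=\frac1{2n}\sum_{j=1}^{2n}\mu^j_{\{T_i\}}$, where $\mu^j_{\{T_i\}}$ is the g.d.s.m. of the $2n+1$ maps $T_1,\dots,T_{2n},T_j$. In (ii), $(\mu_{\{T_i\}}\circ f^{-1})(A)=\mu_{\{T_i\}}(f^{-1}(A))$. For real-valued maps $T_1,\dots,T_{2n-1}$ the $n$th order statistic $T_{(n)}$ (the sample median) assigns to $y$ the $n$th smallest of the values $T_i(y)$. *)

(* Defs.v *)
From HB Require Import structures.
From mathcomp Require Export all_boot all_order all_algebra.
From mathcomp Require Export all_classical all_reals all_analysis.

Set Implicit Arguments.
Unset Strict Implicit.
Unset Printing Implicit Defensive.

Import Order.TTheory GRing.Theory Num.Theory.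
Import numFieldNormedType.Exports.

Local Open Scope classical_set_scope.
Local Open Scope ring_scope.

(* [connected set0] holds in the library, as required here.
   [precompact] is relative to the ambient space [X]; by [precompactE] it means
   that the closure is compact. *)
Definition solid (X : topologicalType) (A : set X) : Prop :=
  [/\ connected A,
      compact [set: X] -> connected (~` A) &
      ~ compact [set: X] ->
        forall x, (~` A) x -> ~ precompact (connected_component (~` A) x)].

(* The family A_s^*(X). *)
Definition bounded_solid (X : topologicalType) (A : set X) : Prop :=
  solid A /\ (compact A \/ (open A /\ precompact A)).

(* The partitions are finite: the partition into singletons, which are solid
   and closed in, say, a sphere, is not meant to be excluded. *)
Definition genus0 (X : topologicalType) : Prop :=
  forall (k : nat) (A : 'I_k -> set X),
    (forall i, [/\ A i !=set0, solid (A i) & open (A i) \/ closed (A i)]) ->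
    trivIset [set: 'I_k] A -> \bigcup_i A i = [set: X] -> (k <= 2)%N.

Definition locally_connected (X : topologicalType) : Prop :=
  forall (x : X) (U : set X), nbhs x U ->
    exists V : set X, [/\ open V, connected V, V x & V `<=` U].

Definition qspace (X : topologicalType) : Prop :=
  [/\ compact [set: X], hausdorff_space X, connected [set: X],
      locally_connected X & genus0 X].

Definition noncompact_qspace (X : topologicalType) : Prop :=
  [/\ ~ compact [set: X] /\ locally_compact [set: X], hausdorff_space X,
      connected [set: X], locally_connected X &
      genus0 (one_point_compactification X)].

Definition proper_map (X Y : topologicalType) (f : X -> Y) : Prop :=
  forall K : set Y, compact K -> compact (f @^-1` K).

Definition solid_variable (X1 X2 : topologicalType) (f : X1 -> X2) : Prop :=
  continuous f /\
  forall A : set X2, solid A -> open A \/ closed A -> solid (f @^-1` A).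

(* The set functions below are total on [set _]; only their values on open and
   closed (resp. open and compact) sets matter. *)

Definition open_or_compact (X : topologicalType) (A : set X) : Prop :=
  open A \/ compact A.

Record deficient_topological_measure (R : realType) (Y : topologicalType)
    (P : set Y -> \bar R) : Prop := {
  dtm_ge0 : forall A, open A \/ closed A -> (0 <= P A)%E ;
  dtm_not_oo : exists2 A, open A \/ closed A & P A <> +oo%E ;
  dtm_additive : forall A B, compact A -> compact B -> A `&` B = set0 ->
    P (A `|` B) = (P A + P B)%E ;
  dtm_inner : forall U, open U ->
    P U = ereal_sup [set P K | K in [set K | compact K /\ K `<=` U]] ;
  dtm_outer : forall F, closed F ->
    P F = ereal_inf [set P U | U in [set U | open U /\ F `<=` U]]
}.

Record image_transformation (X Y : topologicalType) (q : set X -> set Y) :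
    Prop := {
  it_open : forall U, open U -> open (q U) ;
  it_compact : forall K, compact K -> compact (q K) ;
  it_inner : forall U, open U ->
    q U = \bigcup_(K in [set K | compact K /\ K `<=` U]) q K ;
  it_outer : forall K, compact K ->
    q K = \bigcap_(U in [set U | open U /\ K `<=` U]) q U ;
  it_additive : forall A B, open_or_compact A -> open_or_compact B ->
    open_or_compact (A `|` B) -> A `&` B = set0 ->
    q (A `|` B) = q A `|` q B /\ q A `&` q B = set0
}.

(* For m = 2n - 1 one has uphalf m = n. *)
Definition majority_preimage (m : nat) (X Y : Type) (T : 'I_m -> Y -> X)
    (A : set X) : set Y :=
  \bigcup_(S in (fun S : {set 'I_m} => (uphalf m <= #|S|)%N))
    \bigcap_(i in (fun i => i \in S)) (T i @^-1` A).

(* For m odd: q is the (unique) image transformation extending the majority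
   preimage from A_s^*(X). *)
Definition is_median_transformation (m : nat) (X Y : topologicalType)
    (T : 'I_m -> Y -> X) (q : set X -> set Y) : Prop :=
  image_transformation q /\
  forall A, bounded_solid A -> q A = majority_preimage T A.

Definition is_gdsm_odd (R : realType) (m : nat) (X Y : topologicalType)
    (P : set Y -> \bar R) (T : 'I_m -> Y -> X) (mu : set X -> \bar R) : Prop :=
  exists2 q, is_median_transformation T q &
    forall A, open_or_compact A -> mu A = P (q A).

(* T_1, ..., T_m, T_j *)
Definition repeat_map (m : nat) (X Y : Type) (T : 'I_m -> Y -> X) (j : 'I_m) :
    'I_m.+1 -> Y -> X :=
  fun i => if unlift ord_max i is Some k then T k else T j.

(* [mu], restricted to the open and the compact sets, is the generalized
   distribution of the sample median of the m maps T_i. *)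
Definition is_gdsm (R : realType) (m : nat) (X Y : topologicalType)
    (P : set Y -> \bar R) (T : 'I_m -> Y -> X) (mu : set X -> \bar R) : Prop :=
  if odd m then is_gdsm_odd P T mu
  else exists2 nu : 'I_m -> set X -> \bar R,
    forall j, is_gdsm_odd P (repeat_map T j) (nu j) &
    forall A, open_or_compact A ->
      mu A = ((m%:R^-1)%:E * \sum_(j < m) nu j A)%E.

(* The k-th smallest (k = 1, ..., m.+1) of the values T_i(y), counted with
   multiplicity, as a point of D. *)
Definition order_statistic (R : realType) (D : set R) (m : nat) (Y : Type)
    (k : nat) (T : 'I_m.+1 -> Y -> D) (y : Y) : D :=
  nth (T ord0 y)
      (sort (fun a b : D => \val a <= \val b) [seq T i y | i <- enum 'I_m.+1])
      k.-1.

(* Main.v *)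
(** Part (ii): B |-> q (f^-1 B) is an image transformation, because a proper map
    is closed, and it agrees with the majority preimage of the f o T_i on
    A_s^*(X_2). It remains to see that an image transformation of a connected,
    locally connected, locally compact space is determined by its values on
    A_s^*. By additivity over the components of an open set and by inner
    regularity it is determined on open sets by its values on compact connected
    sets C. Adding to C the precompact components of its complement gives a
    compact solid set, its solid hull, and these components are themselves
    open, precompact and solid; so q C is recovered by subtraction.

    Part (i): as the circle does not have genus 0, a noncompact q-space in R has
    exactly one endpoint. Hence solid sets are initial or final segments, while
    the closed rays from one end are solid, which forces f to be monotone; and
    the middle order statistic is invariant under reversal of the order. *)

Require Import Defs.
From HB Require Import structures.
From mathcomp Require Import all_boot all_order all_algebra.
From mathcomp Require Import all_classical all_reals all_analysis.

Set Implicit Arguments.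
Unset Strict Implicit.
Unset Printing Implicit Defensive.

Import Order.TTheory GRing.Theory Num.Theory.
Import numFieldNormedType.Exports.

Local Open Scope classical_set_scope.
Local Open Scope ring_scope.

(** * Compactness, connectedness and components *)

(** The members of [P], directed by inclusion, generate a filter; compactness in its near-covering
    form then yields one member containing [K]. This replaces the choice of finite subcovers
    below. *)
Lemma compact_union_ind (X : topologicalType) (K : set X)
    (P : set X -> Prop) :
  compact K -> P set0 -> (forall U V, P U -> P V -> P (U `|` V)) ->
  (forall x, K x -> exists2 U, nbhs x U & P U) ->
  exists2 V, K `<=` V & P V.
Proof.
move=> /compact_near_coveringP cK P0 PU Ploc.
pose F : set_system (set X) :=
  filter_from P (fun U => [set V | P V /\ U `<=` V]).
have FF : Filter F.
  apply: filter_from_filter; first by exists set0.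
  move=> U V pU pV; exists (U `|` V); first exact: PU.
  by move=> W [pW UVW]; split; split=> // x ?; apply: UVW; [left|right].
have [|U pU UK] := cK _ F (fun V x => V x) FF.
  move=> x /Ploc[U xU pU]; exists (U, [set V | P V /\ U `<=` V]) => /=.
    by split=> //; exists U.
  by case=> y V /= [Uy [_ UV]]; exact: UV.
by exists U => //; apply: (UK U); split.
Qed.

(** A separation of the union has each of [A], [B] on one side. Were the sides different, the common
    point would lie in one side and in the closure of the other. *)
Lemma connected_closureU (X : topologicalType) (A B : set X) :
  closure A `&` B !=set0 -> connected A -> connected B -> connected (A `|` B).
Proof.
move=> [p [clAp Bp]] cA cB; apply/connectedP => E [E0 AB sE].
have sub (D : set X) : connected D -> D `<=` A `|` B -> exists b, D `<=` E b.
  move=> cD DAB; have [] := connected_subset sE _ cD; first by rewrite -AB.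
    by exists false.
  by exists true.
have cl_disj b x : closure (E b) x -> ~ E (~~ b) x.
  move: sE => [E1 E2]; case: b => cx ex.
    by have : set0 x by rewrite -E2.
  by have : set0 x by rewrite -E1.
have [a Aa] : exists b, A `<=` E b by apply: sub => // x; left.
have [b Bb] : exists b, B `<=` E b by apply: sub => // x; right.
have [ab|ab] := eqVneq a b; last first.
  apply: (cl_disj a p); first exact: closureS clAp.
  suff -> : ~~ a = b by exact: Bb.
  by case: a b ab {Aa Bb} => [] [].
subst b; have [x Ex] := E0 (~~ a).
have : (A `|` B) x by rewrite AB; case: (~~ a) Ex; [right|left].
by case=> [/Aa|/Bb] /subset_closure /cl_disj.
Qed.

Lemma component_open (X : topologicalType) (U : set X) (x : X) :
  locally_connected X -> open U -> open (connected_component U x).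
Proof.
move=> lcX oU; rewrite openE => y xy.
have Uy : U y by exact: connected_component_sub xy.
have [V [oV cV Vy VU]] := lcX y U (open_nbhs_nbhs (conj oU Uy)).
rewrite /interior (same_connected_component xy).
apply: filterS (open_nbhs_nbhs (conj oV Vy)).
exact: connected_component_max.
Qed.

(** Otherwise the closure of the component is a connected set missing [C], hence equal to the
    component, which is then open and closed in a connected space. *)
Lemma component_closure_meets (X : topologicalType) (C : set X) (x : X) :
  connected [set: X] -> locally_connected X -> closed C -> C !=set0 -> ~ C x ->
  closure (connected_component (~` C) x) `&` C !=set0.
Proof.
move=> cX lcX clC [c Cc] nCx; apply: contrapT => nmeet.
set W := connected_component (~` C) x.
have Wx : W x by exact: connected_component_refl.
have clW : closure W `<=` W.
  apply: connected_component_max; first exact: subset_closure.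
    by move=> y Wy Cy; apply: nmeet; exists y.
  exact/connected_closure/component_connected.
suff WT : W = setT.
  by have /connected_component_sub : W c by rewrite WT.
apply: cX; first by exists x.
  by exists W; [exact/component_open/closed_openC|rewrite setTI].
exists W; last by rewrite setTI.
by rewrite closure_id eqEsubset; split=> //; exact: subset_closure.
Qed.

(** [D] is [C] together with whole components of its complement, each attached to [C] through its
    closure. *)
Lemma connected_saturated (X : topologicalType) (C D : set X) :
  connected [set: X] -> locally_connected X -> closed C -> C !=set0 ->
  connected C -> C `<=` D ->
  (forall x, D x -> ~ C x -> connected_component (~` C) x `<=` D) ->
  connected D.
Proof.
move=> cX lcX clC C0 cC CD sat.
have -> : D = \bigcup_(x in D) (connected_component (~` C) x `|` C).
  apply/seteqP; split=> [x Dx|y [x Dx []]].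
  - exists x => //; have [Cx|nCx] := pselect (C x); first by right.
    by left; exact: connected_component_refl.
  - have [Cx|nCx] := pselect (C x); last exact: sat.
    by rewrite connected_component_out.
  - exact: CD.
apply: bigcup_connected.
  by have [c Cc] := C0; exists c => x _; right.
move=> x Dx; have [Cx|nCx] := pselect (C x).
  by rewrite connected_component_out ?set0U.
apply: connected_closureU => //; first exact: component_closure_meets.
exact: component_connected.
Qed.

Lemma compact_nbhs_subset (X : topologicalType) (U : set X) (x : X) :
  hausdorff_space X -> locally_compact [set: X] -> nbhs x U ->
  exists V, [/\ nbhs x V, closed V, compact V & V `<=` U].
Proof.
move=> hX lX xU; have [W + [cW clW]] := lX x I; rewrite withinET => xW.
have [V xV VUW] := compact_regular hX cW xW (filterI xU xW).
exists (closure V); split.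
- by apply: filterS xV; exact: subset_closure.
- exact: closed_closure.
- by apply: (subclosed_compact (@closed_closure _ V) cW) => y /VUW[].
- by move=> y /VUW[].
Qed.

Lemma compact_connected_nbhs (X : topologicalType) (U : set X) (x : X) :
  hausdorff_space X -> locally_compact [set: X] -> locally_connected X ->
  nbhs x U ->
  exists V, [/\ nbhs x V, connected V, compact V & V `<=` U].
Proof.
move=> hX lX lcX xU; have [V [xV clV cV VU]] := compact_nbhs_subset hX lX xU.
have [W [oW cW Wx WV]] := lcX x V xV.
have clWV : closure W `<=` V.
  by move=> y Wy; rewrite (iffLR (closure_id V) clV); exact: closureS Wy.
exists (closure W); split.
- by apply: filterS (open_nbhs_nbhs (conj oW Wx)); exact: subset_closure.
- exact: connected_closure.
- exact: (subclosed_compact (@closed_closure _ W) cV clWV).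
- exact: subset_trans VU.
Qed.

(** The points having a compact connected neighbourhood in [U] that contains [x0] form a set open
    and closed in [U], hence all of [U]. Finitely many such neighbourhoods cover [K], and their
    union is connected through [x0]. *)
Lemma compact_in_connected_open (X : topologicalType) (U K : set X) :
  hausdorff_space X -> locally_compact [set: X] -> locally_connected X ->
  open U -> connected U -> compact K -> K !=set0 -> K `<=` U ->
  exists C, [/\ compact C, connected C, K `<=` C & C `<=` U].
Proof.
move=> hX lX lcX oU cU cK [x0 Kx0] KU.
pose P C := [/\ compact C, connected C, C x0 & C `<=` U].
have PU C D : compact D -> connected D -> C `&` D !=set0 -> D `<=` U -> P C ->
    P (C `|` D).
  move=> cD coD CD DU [cC coC Cx0 CU]; split; first exact: compactU.
  - exact: connectedU.
  - by left.
  - by move=> y [/CU|/DU].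
pose B := [set x : X | exists2 C : set X, P C & nbhs x C].
have BU : B `<=` U.
  by move=> x [C [_ _ _ CU] /nbhs_singleton]; exact: CU.
have oB : open B.
  rewrite openE => x [C PC]; rewrite nbhsE => -[V [oV Vx] VC].
  apply: filterS (open_nbhs_nbhs (conj oV Vx)) => y Vy; exists C => //.
  exact: filterS VC (open_nbhs_nbhs (conj oV Vy)).
have Bcl : U `&` closure B `<=` B.
  move=> x [Ux clBx].
  have [N [xN cN cpN NU]] :=
    compact_connected_nbhs hX lX lcX (open_nbhs_nbhs (conj oU Ux)).
  have [y [[C PC /nbhs_singleton Cy] Ny]] := clBx N xN.
  exists (C `|` N); last by apply: filterS xN; right.
  by apply: PU => //; exists y.
have Bx0 : B x0.
  have [N [xN cN cpN NU]] :=
    compact_connected_nbhs hX lX lcX (open_nbhs_nbhs (conj oU (KU _ Kx0))).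
  by exists N => //; split => //; exact: nbhs_singleton.
have BeqU : B = U.
  apply: cU; first by exists x0.
  - by exists B => //; apply/seteqP; split=> [y By|y []//]; split=> //; exact: BU.
  - exists (closure B); first exact: closed_closure.
    apply/seteqP; split=> // y By; split; first exact: BU.
    exact: subset_closure.
pose Q V := exists2 C, P C & V `<=` C.
have [||x Kx|V KV [C [cC coC _ CU] VC]] :=
  @compact_union_ind X K Q cK.
- by exists [set x0] => //; split;
    [exact: compact_set1|exact: connected1| |move=> _ ->; exact: KU].
- move=> V W [C PC VC] [D [cD coD Dx0 DU] WD]; exists (C `|` D).
    by apply: PU => //; exists x0; split=> //; case: PC.
  exact: setUSS.
- by have : B x by [rewrite BeqU; exact: KU]; case=> C PC xC; exists C => //; exists C.
- by exists C; split=> //; exact: subset_trans VC.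
Qed.

(** * Solid hulls *)

(** The complement of the component is [C] with the other components, so it is connected. If [X] is
    not compact, this complement is not precompact, since two precompact sets cannot cover [X]. *)
Lemma solid_component (X : topologicalType) (C : set X) (x : X) :
  connected [set: X] -> locally_connected X -> closed C -> connected C ->
  C !=set0 -> precompact (connected_component (~` C) x) ->
  bounded_solid (connected_component (~` C) x).
Proof.
move=> cX lcX clC cC C0 pW; set W := connected_component (~` C) x.
have cWC : connected (~` W).
  apply: (@connected_saturated _ C) => //.
    by move=> y Cy /connected_component_sub.
  move=> y nWy nCy z yz xz; apply: nWy.
  by apply: connected_component_trans xz _; exact: connected_component_sym.
split; last by right; split=> //; exact/component_open/closed_openC.
split=> //; first exact: component_connected.
move=> nX y nWy; rewrite connected_component_id// => pWC; apply: nX.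
have : compact (closure W `|` closure (~` W)).
  by apply: compactU; rewrite -precompactE.
congr compact; apply/seteqP; split=> // z _.
by have [Wz|Wz] := pselect (W z); [left|right]; exact: subset_closure.
Qed.

(** In a compact space every component is precompact and the hull is the whole space. *)
Definition solid_hull (X : topologicalType) (C : set X) : set X :=
  C `|` [set x | ~ C x /\ precompact (connected_component (~` C) x)].

Lemma subset_solid_hull (X : topologicalType) (C : set X) : C `<=` solid_hull C.
Proof. by move=> x; left. Qed.

Lemma component_solid_hull (X : topologicalType) (C : set X) (x : X) :
  solid_hull C x -> ~ C x -> connected_component (~` C) x `<=` solid_hull C.
Proof.
move=> [//|[_ pW]] nCx y xy; right; split; first exact: connected_component_sub xy.
by rewrite -(same_connected_component xy).
Qed.

Lemma component_solid_hullC (X : topologicalType) (C : set X) (x : X) :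
  ~ solid_hull C x -> connected_component (~` C) x `<=` ~` solid_hull C.
Proof.
move=> nhx y xy [Cy|[nCy pW]]; first exact: (connected_component_sub xy).
apply: nhx; right; split; last by rewrite (same_connected_component xy).
by move=> Cx; move: xy; rewrite connected_component_out.
Qed.

Lemma solid_hull_closed (X : topologicalType) (C : set X) :
  locally_connected X -> closed C -> closed (solid_hull C).
Proof.
move=> lcX clC; rewrite -openC openE => x nhx.
have nCx : ~ C x by move=> Cx; apply: nhx; left.
apply: filterS (component_solid_hullC nhx) _; apply: open_nbhs_nbhs.
by split; [exact/component_open/closed_openC|exact: connected_component_refl].
Qed.

(** Let [V] be a precompact open set around [C]. A precompact component not inside [V] meets the
    boundary of [V], which is compact and covered by disjoint open components; so only finitely many
    are involved. *)
Lemma solid_hull_compact (X : topologicalType) (C : set X) :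
  hausdorff_space X -> locally_compact [set: X] -> connected [set: X] ->
  locally_connected X -> compact C -> C !=set0 -> compact (solid_hull C).
Proof.
move=> hX lX cX lcX cC C0; have clC : closed C by exact: compact_closed.
suff pH : precompact (solid_hull C).
  by rewrite -precompact_closed //; exact: solid_hull_closed.
have pU (A B : set X) : precompact A -> precompact B -> precompact (A `|` B).
  by rewrite !precompactE closureU; exact: compactU.
have p0 : precompact (@set0 X) by rewrite precompactE closure0; exact: compact0.
have [|||V CV [oV pV]] := @compact_union_ind X C (fun V => open V /\ precompact V) cC.
- by split; [exact: open0|].
- by move=> U V [oU ?] [oV ?]; split; [exact: openU|exact: pU].
- move=> x _; have [W + [cW clW]] := lX x I; rewrite withinET => xW.
  exists W^°; first exact: nbhs_interior.
  split; first exact: open_interior.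
  by apply: precompact_subset (@interior_subset _ _) _; rewrite precompact_closed.
pose P U := exists2 W : set X, precompact W & forall x,
  connected_component (~` C) x `&` U !=set0 ->
  precompact (connected_component (~` C) x) -> connected_component (~` C) x `<=` W.
have cB : compact (closure V `\` V).
  apply: (@subclosed_compact _ _ (closure V)); last by move=> ? [].
    by apply: closedI; [exact: closed_closure|exact: open_closedC].
  by rewrite -precompactE.
have [||x [_ nVx]|U BU [W pW UW]] := @compact_union_ind X _ P cB.
- by exists set0 => // x []; rewrite setI0 => ? [].
- move=> U1 U2 [W1 pW1 W1P] [W2 pW2 W2P]; exists (W1 `|` W2); first exact: pU.
  move=> x [y [xy [U1y|U2y]]] pW z xz.
    by left; apply: W1P xz => //; exists y.
  by right; apply: W2P xz => //; exists y.
(* The component of a boundary point is a neighbourhood of it that meets no other component. *)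
- have nCx : ~ C x by move=> /CV.
  exists (connected_component (~` C) x).
    apply: open_nbhs_nbhs; split; first exact/component_open/closed_openC.
    exact: connected_component_refl.
  have same z y : connected_component (~` C) z y ->
      connected_component (~` C) x y ->
      connected_component (~` C) z = connected_component (~` C) x.
    by move=> zy xy; rewrite (same_connected_component zy)
      (same_connected_component xy).
  have [pW|npW] := pselect (precompact (connected_component (~` C) x)).
    exists (connected_component (~` C) x) => // z [y [zy /(same _ _ zy)->]] _.
    exact: subset_refl.
  by exists set0 => // z [y [zy /(same _ _ zy)->]] /npW.
apply: (@precompact_subset _ _ (V `|` W)); last exact: pU.
move=> x [/CV|[nCx pX]]; first by left.
have [Vx|nVx] := pselect (V x); [by left|right].
apply: (UW x) => //; last exact: connected_component_refl.
(* A component avoiding the boundary of V is inside V, since its closure meets C. *)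
apply: contrapT => nmeet.
set Z := connected_component (~` C) x in nmeet.
have [y [clZy /CV Vy]] := component_closure_meets cX lcX clC C0 nCx.
have [z [Zz Vz]] := clZy V (open_nbhs_nbhs (conj oV Vy)).
have ZV : Z `&` V = Z.
  apply: (@component_connected _ (~` C) x); first by exists z.
    by exists V.
  exists (closure V); first exact: closed_closure.
  apply/seteqP; split=> t [Zt Vt]; split=> //; first exact: subset_closure.
  apply: contrapT => nVt; apply: nmeet; exists t; split=> //.
  exact: BU.
apply: nVx; have : Z x by exact: connected_component_refl.
by rewrite -ZV => -[].
Qed.

(** In the noncompact case, take a point outside the hull. Its component in the complement of [C]
    avoids the hull, so it lies in a component of the complement of the hull; were the latter
    precompact, the point would belong to the hull. *)
Lemma solid_hull_solid (X : topologicalType) (C : set X) :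
  hausdorff_space X -> locally_compact [set: X] -> connected [set: X] ->
  locally_connected X -> compact C -> connected C -> C !=set0 ->
  bounded_solid (solid_hull C).
Proof.
move=> hX lX cX lcX cC coC C0; have clC : closed C by exact: compact_closed.
split; last by left; exact: solid_hull_compact.
split.
- apply: (@connected_saturated _ C) => //; first exact: subset_solid_hull.
  exact: component_solid_hull.
- move=> cpX; suff -> : ~` solid_hull C = set0 by exact: connected0.
  rewrite -subset0 => x nhx; apply: nhx.
  have [Cx|nCx] := pselect (C x); [by left|right; split=> //].
  by rewrite precompactE; exact: (subclosed_compact (@closed_closure _ _) cpX).
- move=> ncX x nhx pH; apply: (nhx); right.
  have nCx : ~ C x by move=> Cx; apply: nhx; left.
  split=> //; apply: precompact_subset pH.
  apply: connected_component_max; first exact: connected_component_refl.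
    exact: component_solid_hullC.
  exact: component_connected.
Qed.

(** * Image transformations are determined by bounded solid sets *)

Lemma it_mono (X Y : topologicalType) (q : set X -> set Y) (A B : set X) :
  image_transformation q -> open_or_compact A -> open_or_compact B ->
  A `<=` B -> q A `<=` q B.
Proof.
move=> qt.
have KU K U : compact K -> open U -> K `<=` U -> q K `<=` q U.
  by move=> cK oU KU z qz; rewrite (it_inner qt oU); exists K.
have UU U V : open U -> open V -> U `<=` V -> q U `<=` q V.
  move=> oU oV UV y; rewrite (it_inner qt oU) => -[K [cK KsU]].
  by apply: KU => //; exact: subset_trans UV.
move=> [oA|cA] [oB|cB] AB; [exact: UU| |exact: KU|].
  rewrite (it_outer qt cB) => y qy U [oU BU].
  by apply: (UU A) => //; exact: subset_trans BU.
rewrite (it_outer qt cA) (it_outer qt cB) => y qA U [oU BU].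
by apply: qA; split=> //; exact: subset_trans BU.
Qed.

Lemma it_set0 (X Y : topologicalType) (q : set X -> set Y) :
  image_transformation q -> q set0 = set0.
Proof.
move=> qt; have o0 : open_or_compact (@set0 X) by left; exact: open0.
by have [||_] := it_additive qt o0 o0; rewrite ?setU0 ?setI0 // setIid.
Qed.

(** Additivity asks for disjoint sets; the difference is open when both sets are unions of
    components of one open set, the case needed next. *)
Lemma it_open_setU (X Y : topologicalType) (q : set X -> set Y) (U V : set X) :
  image_transformation q -> open U -> open V -> open (V `\` U) ->
  q (U `|` V) `<=` q U `|` q V.
Proof.
move=> qt oU oV oVU; have -> : U `|` V = U `|` (V `\` U).
  by rewrite setDE setUIr setUv setIT.
have [||||-> _] := it_additive qt (_ : open_or_compact U)
  (_ : open_or_compact (V `\` U)); rewrite ?setDIK //.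
- by left.
- by left.
- by left; exact: openU.
apply: setUS; apply: (it_mono qt); [by left|by left|exact: subDsetl].
Qed.

(** [q] is only finitely additive, but a point of [q U] lies in [q K] for some compact [K] inside
    [U], and finitely many components cover [K]. *)
Lemma it_components (X Y : topologicalType) (q : set X -> set Y) (U : set X) :
  locally_connected X -> image_transformation q -> open U ->
  q U `<=` \bigcup_(x in U) q (connected_component U x).
Proof.
move=> lcX qt oU y; rewrite {1}(it_inner qt oU) => -[K [cK KU] qKy].
have ocp x : open (connected_component U x) by exact: component_open.
(* Saturation makes the difference of two such open sets open, as [it_open_setU] requires. *)
pose sat V := forall x, V x -> connected_component U x `<=` V.
pose P V := [/\ open V, V `<=` U, sat V &
  q V `<=` \bigcup_(x in V) q (connected_component U x)].
have [||x Kx|V KV [oV VU _ qV]] := @compact_union_ind X K P cK.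
- by split => //; [exact: open0|rewrite it_set0].
- move=> V W [oV VU sV qV] [oW WU sW qW]; split; first exact: openU.
  + by rewrite subUset.
  + by move=> x [Vx|Wx] z xz; [left; exact: (sV x)|right; exact: (sW x)].
  have oWV : open (W `\` V).
    rewrite openE => x [Wx nVx].
    apply: (@filterS _ _ _ (connected_component U x)); last first.
      apply: open_nbhs_nbhs; split=> //.
      by apply: connected_component_refl; exact: WU.
    move=> z xz; split; first exact: (sW x).
    by move=> Vz; apply: nVx; apply: (sV z) => //; exact: connected_component_sym.
  move=> z /(it_open_setU qt oV oW oWV)[/qV|/qW] [x ? ?]; exists x => //.
    by left.
  by right.
- have Ux := KU x Kx; exists (connected_component U x).
    by apply: open_nbhs_nbhs; split=> //; exact: connected_component_refl.
  split=> //; first exact: connected_component_sub.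
    by move=> z xz; rewrite (same_connected_component xz).
  by move=> z qz; exists x => //; exact: connected_component_refl.
have [|x Vx qx] := qV y; last by exists x => //; exact: VU.
by apply: it_mono qKy => //; [right|left].
Qed.

Section uniqueness.
Variables (X Y : topologicalType) (q1 q2 : set X -> set Y).
Hypotheses (hX : hausdorff_space X) (lX : locally_compact [set: X])
  (cX : connected [set: X]) (lcX : locally_connected X).
Hypotheses (qt1 : image_transformation q1) (qt2 : image_transformation q2)
  (q12 : forall A, bounded_solid A -> q1 A = q2 A).

(** The hull [H] is the disjoint union of [C] and an open [V] whose components are bounded solid. A
    point of [q1 C] lies in [q1 H = q2 H]; were it in [q2 V], it would lie in [q2 W = q1 W] for a
    component [W] of [V], hence in [q1 V], which is disjoint from [q1 C]. *)
Let it_eq_connected_compact C : compact C -> connected C -> q1 C `<=` q2 C.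
Proof.
move=> cC coC; have [->|/set0P C0] := eqVneq C set0; first by rewrite !it_set0.
have clC : closed C by exact: compact_closed.
set H := solid_hull C; have sH : bounded_solid H by exact: solid_hull_solid.
have cH : compact H by exact: solid_hull_compact.
have CH : C `<=` H by exact: subset_solid_hull.
set V := H `\` C.
have compV x : V x -> connected_component (~` C) x `<=` V.
  move=> [Hx nCx] z xz; split; first exact: component_solid_hull xz.
  exact: (connected_component_sub xz).
have oV : open V.
  rewrite openE => x Vx; apply: filterS (compV x Vx) _.
  apply: open_nbhs_nbhs; split; first exact/component_open/closed_openC.
  by apply: connected_component_refl; case: Vx.
have CVE : C `|` V = H by rewrite setDUK.
have CV0 : C `&` V = set0 by rewrite setDIK.
have HE (q : set X -> set Y) : image_transformation q -> q H = q C `|` q V /\ q C `&` q V = set0.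
  move=> qt; rewrite -CVE; apply: it_additive => //; [by right|by left|].
  by right; rewrite CVE.
move=> y q1y; have : q1 H y by rewrite (HE _ qt1).1; left.
rewrite q12 // (HE _ qt2).1 => -[//|/(it_components lcX qt2 oV)[x Vx]].
have -> : connected_component V x = connected_component (~` C) x.
  apply/seteqP; split; apply: connected_component_max.
  - exact: connected_component_refl.
  - by move=> z /connected_component_sub[].
  - exact: component_connected.
  - by apply: connected_component_refl; case: Vx.
  - exact: compV.
  - exact: component_connected.
rewrite -q12; last first.
  by apply: solid_component => //; case: Vx => -[//|[]].
move=> q1W; suff : (q1 C `&` q1 V) y by rewrite (HE _ qt1).2.
split=> //; apply: it_mono (compV x Vx) _ q1W => //.
  by left; exact/component_open/closed_openC.
by left.
Qed.

(** One inclusion is enough, the hypotheses being symmetric in [q1] and [q2]. A compact subset of a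
    component is enlarged within it to a compact connected set. *)
Lemma it_eq_open U : open U -> q1 U `<=` q2 U.
Proof.
move=> oU y /(it_components lcX qt1 oU)[x Ux].
have oW : open (connected_component U x) by exact: component_open.
rewrite (it_inner qt1 oW) => -[K [cK KW] q1K].
have [K0|/set0P K0] := eqVneq K set0; first by rewrite K0 it_set0 in q1K.
have [C [cC coC KC CW]] := compact_in_connected_open hX lX lcX oW
  (@component_connected _ U x) cK K0 KW.
apply: (@it_mono _ _ _ C) => //; [by right|by left| |].
  by apply: subset_trans CW _; exact: connected_component_sub.
by apply: it_eq_connected_compact => //; apply: it_mono KC _ q1K => //; right.
Qed.

End uniqueness.

Lemma it_unique (X Y : topologicalType) (q1 q2 : set X -> set Y) (A : set X) :
  hausdorff_space X -> locally_compact [set: X] -> connected [set: X] ->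
  locally_connected X -> image_transformation q1 -> image_transformation q2 ->
  (forall B, bounded_solid B -> q1 B = q2 B) -> open_or_compact A ->
  q1 A = q2 A.
Proof.
move=> hX lX cX lcX qt1 qt2 q12.
have q21 B : bounded_solid B -> q2 B = q1 B by move=> /q12.
have oE U : open U -> q1 U = q2 U.
  by move=> oU; rewrite eqEsubset; split; exact: it_eq_open.
move=> [/oE//|cA]; rewrite (it_outer qt1 cA) (it_outer qt2 cA).
by apply: eq_bigcapr => U [/oE].
Qed.

(** * Pulling back along a proper solid variable *)

(** Inside a compact neighbourhood [W] of [y], the image of [F] agrees with the image of the part of
    [F] over [W], which is compact and hence closed. *)
Lemma proper_map_closed (X Y : topologicalType) (f : X -> Y) (F : set X) :
  hausdorff_space X -> hausdorff_space Y -> locally_compact [set: Y] ->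
  continuous f -> proper_map f -> closed F -> closed (f @` F).
Proof.
move=> hX hY lY cf pf clF y yF.
have [W + [cW clW]] := lY y I; rewrite withinET => yW.
have cK : compact (f @` (F `&` f @^-1` W)).
  apply: continuous_compact; first exact: continuous_subspaceT.
  by rewrite setIC; apply: compact_closedI => //; exact: pf.
suff : closure (f @` (F `&` f @^-1` W)) y.
  rewrite -(iffLR (closure_id _) (compact_closed hY cK)).
  by move=> [x [Fx _] <-]; exists x.
move=> V yV; have [_ [[x Fx <-] [Vx Wx]]] := yF _ (filterI yV yW).
by exists (f x); split=> //; exists x.
Qed.

Lemma it_comp_preimage (X1 X2 Y : topologicalType) (f : X1 -> X2)
    (q : set X1 -> set Y) :
  hausdorff_space X1 -> hausdorff_space X2 -> locally_compact [set: X2] ->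
  continuous f -> proper_map f -> image_transformation q ->
  image_transformation (fun A => q (f @^-1` A)).
Proof.
move=> h1 h2 l2 cf pf qt.
have of_ U : open U -> open (f @^-1` U) by move/continuousP: cf; apply.
have ocf A : open_or_compact A -> open_or_compact (f @^-1` A).
  by move=> [/of_|/pf]; [left|right].
split=> [U /of_ /(it_open qt)//|K /pf /(it_compact qt)//|U oU|K cK|
  A B oA oB oAB AB].
- apply/seteqP; split=> y; last first.
    move=> [K [cK KU]]; apply: it_mono => //; [by apply: ocf; right|
      by apply: ocf; left|exact: preimage_subset].
  rewrite {1}(it_inner qt (of_ _ oU)) => -[K [cK KU] qK].
  have cfK : compact (f @` K).
    by apply: continuous_compact => //; exact: continuous_subspaceT.
  exists (f @` K); first by split=> // _ [x /KU + <-].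
  apply: it_mono (@preimage_image _ _ f K) _ qK => //; first by right.
  by apply: ocf; right.
- apply/seteqP; split=> y.
    move=> qy U [oU KU]; apply: it_mono qy => //; [by apply: ocf; right|
      by apply: ocf; left|exact: preimage_subset].
  rewrite (it_outer qt (pf _ cK)) => qy V [oV KV].
  (* The largest set whose preimage lies in [V] is the complement of this image; it is open since
     [f] is closed. *)
  have clV : closed (f @` (~` V)) by apply: proper_map_closed => //; exact: open_closedC.
  have oU := closed_openC clV.
  apply: (@it_mono _ _ _ (f @^-1` (~` (f @` (~` V))))) => //.
  + by left; exact: of_.
  + by left.
  + by move=> x nfx; apply: contrapT => nVx; apply: nfx; exists x.
  + apply: qy; split=> // z Kz [x nVx fxz]; apply: nVx; apply: KV.
    by rewrite /preimage /= fxz.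
- rewrite preimage_setU; apply: it_additive => //; [exact: ocf|exact: ocf| |].
    by rewrite -preimage_setU; exact: ocf.
  by rewrite -preimage_setI AB preimage_set0.
Qed.

Lemma bounded_solid_preimage (X1 X2 : topologicalType) (f : X1 -> X2)
    (A : set X2) :
  hausdorff_space X2 -> solid_variable f -> proper_map f ->
  bounded_solid A -> bounded_solid (f @^-1` A).
Proof.
move=> h2 [cf sf] pf [sA [cA|[oA pA]]].
  split; last by left; exact: pf.
  by apply: sf => //; right; exact: compact_closed.
split; first by apply: sf => //; left.
right; split; first by move/continuousP: cf; apply.
exists (f @^-1` closure A).
  by move=> x Ax; exact: subset_closure.
split; first by apply: pf; rewrite -precompactE.
by apply: preimage_closed => //; exact: closed_closure.
Qed.

Lemma qspace_basics (X : topologicalType) :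
  qspace X \/ noncompact_qspace X ->
  [/\ hausdorff_space X, locally_compact [set: X], connected [set: X] &
      locally_connected X].
Proof.
move=> [[cX hX coX lcX _]|[[_ lX] hX coX lcX _]]; split=> //.
move=> x _; rewrite withinET; exists setT; first exact: filterT.
by split=> //; exact: closedT.
Qed.

(** The pullback of [q] is a median transformation for the maps [f \o T i]. By uniqueness every
    other one agrees with it; conversely it is itself the required witness. *)
Lemma gdsm_odd_equivariant (R : realType) (X1 X2 Y : topologicalType) (m : nat)
    (T : 'I_m -> Y -> X1) (f : X1 -> X2) (P : set Y -> \bar R)
    (mu : set X1 -> \bar R) (nu : set X2 -> \bar R) :
  qspace X1 \/ noncompact_qspace X1 -> qspace X2 \/ noncompact_qspace X2 ->
  solid_variable f -> proper_map f -> is_gdsm_odd P T mu ->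
  is_gdsm_odd P (fun i => f \o T i) nu <->
  (forall A, open_or_compact A -> nu A = mu (f @^-1` A)).
Proof.
move=> /qspace_basics[h1 l1 c1 lc1] /qspace_basics[h2 l2 c2 lc2] sf pf.
move=> [q [qt qsolid] muE]; have cf : continuous f by case: sf.
have qft := it_comp_preimage h1 h2 l2 cf pf qt.
have qfsolid A : bounded_solid A ->
    q (f @^-1` A) = majority_preimage (fun i => f \o T i) A.
  by move=> /(bounded_solid_preimage h2 sf pf) /qsolid.
have ocf A : open_or_compact A -> open_or_compact (f @^-1` A).
  by move=> [oA|/pf]; [left; move/continuousP: cf; apply|right].
split=> [[r [rt rsolid] nuE] A oA|nuE].
  rewrite nuE // muE; last exact: ocf.
  congr P; apply: (@it_unique _ _ r (fun A => q (f @^-1` A))) => // B sB.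
  by rewrite rsolid // qfsolid.
exists (fun A => q (f @^-1` A)) => // A oA.
by rewrite nuE // muE //; exact: ocf.
Qed.

Lemma gdsm_equivariant (R : realType) (X1 X2 Y : topologicalType) (m : nat)
    (T : 'I_m -> Y -> X1) (f : X1 -> X2) (P : set Y -> \bar R)
    (mu : set X1 -> \bar R) (nu : set X2 -> \bar R) :
  qspace X1 \/ noncompact_qspace X1 -> qspace X2 \/ noncompact_qspace X2 ->
  solid_variable f -> proper_map f -> is_gdsm P T mu ->
  is_gdsm P (fun i => f \o T i) nu <->
  (forall A, open_or_compact A -> nu A = mu (f @^-1` A)).
Proof.
move=> q1 q2 sf pf; rewrite /is_gdsm; case: ifPn => _.
  exact: gdsm_odd_equivariant.
move=> [muj mujP muE].
have ocf A : open_or_compact A -> open_or_compact (f @^-1` A).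
  move=> [oA|/pf]; [left|by right].
  by case: sf => /continuousP cf _; exact: cf.
(* Repeating a map commutes with composition by [f], so the odd case applies to each summand. *)
have fT j : repeat_map (fun i => f \o T i) j = fun i => f \o repeat_map T j i.
  by apply/funext => i; rewrite /repeat_map; case: unlift.
split=> [[nuj nujP nuE] A oA|nuE].
  rewrite nuE // muE; last exact: ocf.
  congr (_ * _)%E; apply: eq_bigr => j _.
  have := nujP j; rewrite fT => nujPj.
  exact: (gdsm_odd_equivariant _ q1 q2 sf pf (mujP j)).1.
exists (fun j A => muj j (f @^-1` A)) => [j|A oA].
  rewrite fT; exact: (gdsm_odd_equivariant _ q1 q2 sf pf (mujP j)).2.
by rewrite nuE // muE //; exact: ocf.
Qed.

(** * Subspaces of the real line *)

(** [g] inverts the inclusion on the image of [A], so compactness and connectedness pass from [X]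
    back to the subtype. A point of [A] serves as the default value off [D]. *)
Lemma set_type_retraction (X : topologicalType) (D : set X) (A : set (set_type D)) :
  A !=set0 -> exists2 g : X -> set_type D,
    {within set_val @` A, continuous g} & g @` (set_val @` A) = A.
Proof.
move=> [a _]; pose g x := insubd a x.
have gK x : g (set_val x) = x by rewrite /g set_valE valKd.
exists g; last first.
  by apply/seteqP; split=> [_ [_ [x Ax <-] <-]|x Ax]; [rewrite gK|
    exists (set_val x) => //; exists x].
apply: (@continuous_subspaceW _ _ _ D); first by move=> _ [x _ <-]; exact: set_valP.
apply/subspace_sigL_continuousP; have -> : sigL D g = id by exact/funext.
by move=> x; exact: cvg_id.
Qed.

Lemma set_type_compact (X : topologicalType) (D : set X) (A : set (set_type D)) :
  compact (set_val @` A) -> compact A.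
Proof.
have [->|/set0P/set_type_retraction[g gc gA] cA] := eqVneq A set0.
  by move=> _; exact: compact0.
by rewrite -gA; exact: continuous_compact.
Qed.

Lemma set_type_connected (X : topologicalType) (D : set X) (A : set (set_type D)) :
  connected (set_val @` A) -> connected A.
Proof.
have [->|/set0P/set_type_retraction[g gc gA] cA] := eqVneq A set0.
  by move=> _; exact: connected0.
by rewrite -gA; exact: connected_continuous_connected.
Qed.

Lemma set_val_continuous (X : topologicalType) (D : set X) :
  continuous (set_val : set_type D -> X).
Proof. exact: initial_continuous. Qed.

Lemma set_type_interval (R : realType) (D : set R) :
  connected [set: set_type D] -> is_interval D.
Proof.
move=> cD; have : connected (set_val @` [set: set_type D]).
  by apply: connected_continuous_connected => //; apply: continuous_subspaceT;
    exact: set_val_continuous.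
move/connected_intervalP; congr is_interval.
apply/seteqP; split=> [_ [x _ <-]|x Dx]; first exact: set_valP.
by exists (SigSub (mem_set Dx)).
Qed.

Section subtypes_of_the_line.
Context {R : realType} {D : set R}.
Implicit Types (b : bool) (x y z : set_type D) (A : set (set_type D)).

(* Reversing the order of the line exchanges [ole true] and [ole false]. *)
Definition ole b x y : bool :=
  if b then \val x <= \val y else \val y <= \val x.

Lemma ole_refl b x : ole b x x.
Proof. by case: b => /=. Qed.

Lemma ole_trans b : transitive (ole b).
Proof.
by case: b => y x z; rewrite /ole; [exact: le_trans|move=> /[swap]; exact: le_trans].
Qed.

Lemma ole_total b : total (ole b).
Proof. by case: b => x y; exact: le_total. Qed.

Lemma ole_anti b : antisymmetric (ole b).
Proof.
by case: b => x y; rewrite /ole => /le_anti /val_inj.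
Qed.

Lemma oleN b x y : ole (~~ b) x y = ole b y x.
Proof. by case: b. Qed.

Lemma oleNge b x y : ~~ ole b x y -> ole b y x.
Proof. by have /orP[->|] := ole_total b x y. Qed.

Lemma closed_ole b y : closed [set x | ole b x y].
Proof.
have vc : continuous (set_val : set_type D -> R) by exact: set_val_continuous.
case: b; [have cl := @closed_le R (\val y)|have cl := @closed_ge R (\val y)].
  by have := preimage_closed (f := set_val) _ cl; apply.
by have := preimage_closed (f := set_val) _ cl; apply.
Qed.

Lemma connected_convex b A x y z : connected A -> A x -> A y ->
  ole b x z -> ole b z y -> A z.
Proof.
move=> cA Ax Ay; have /connected_intervalP iA : connected (set_val @` A).
  by apply: connected_continuous_connected cA _; apply: continuous_subspaceT;
    exact: set_val_continuous.
have vA t : A t -> (set_val @` A) (\val t) by move=> At; exists t.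
wlog -> : b x y Ax Ay / b = true.
  move=> wl; case: b; first exact: wl.
  by rewrite -[false]/(~~ true) !oleN => xz zy; exact: (wl true y x).
move=> /= xz zy; have [|t At /val_inj <-//] := iA _ _ (vA _ Ax) (vA _ Ay) (\val z).
by rewrite xz zy.
Qed.

Hypothesis iD : is_interval D.

(** As [D] is an interval, a set convex in [D] is convex in the line. *)
Lemma convex_connected b A :
  (forall x y z, A x -> A y -> ole b x z -> ole b z y -> A z) -> connected A.
Proof.
move=> cvA; apply/set_type_connected/connected_intervalP.
move=> _ _ [x Ax <-] [y Ay <-] z /[dup] /andP[xz zy] xzy.
have Dz : D z by apply: iD xzy; exact: set_valP.
exists (SigSub (mem_set Dz)) => //.
case: b cvA => cvA; [apply: (cvA x y)|apply: (cvA y x)] => //=.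
Qed.

(** The part of [D] between [x] and [y] is a full segment of the line, hence compact. *)
Lemma precompact_segment b A x y :
  (forall z, A z -> ole b x z && ole b z y) -> precompact A.
Proof.
wlog -> : b x y / b = true.
  move=> wl Axy; case: b Axy => Axy; first exact: (wl true x y).
  by apply: (wl true y x) => // z /Axy; rewrite andbC.
move=> Axy; pose S := [set z | ole false z x] `&` [set z | ole true z y].
exists S; first by move=> z /Axy/andP[].
have cl : closed S by apply: closedI; exact: closed_ole.
split=> //; apply: set_type_compact.
rewrite (_ : _ @` _ = `[\val x, \val y]%classic); first exact: segment_compact.
apply/seteqP; split=> [_ [z [/= xz zy] <-]|z /=]; rewrite in_itv /=.
  by rewrite set_valE xz.
move=> xzy; have Dz : D z by apply: iD xzy; exact: set_valP.
by exists (SigSub (mem_set Dz)) => //; case/andP: xzy.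
Qed.

(** If [ole b] has no last point, the open initial rays cover the space and are directed. The point
    [x] bounds the empty set. *)
Lemma precompact_bounded b A x : precompact A -> exists y, forall z, A z -> ole b z y.
Proof.
rewrite precompactE => cA; have [|noend] := pselect (exists y, forall z, ole b z y).
  by move=> [y ymax]; exists y => z _; exact: ymax.
pose P (V : set (set_type D)) := exists y, forall z, V z -> ole b z y.
have [||z Az|V AV [y Vy]] := @compact_union_ind _ _ P cA.
- by exists x.
- move=> U V [u Uu] [v Vv]; have /orP[uv|vu] := ole_total b u v.
    by exists v => z [/Uu zu|/Vv//]; exact: ole_trans uv.
  by exists u => z [/Uu//|/Vv zv]; exact: ole_trans vu.
- have [y nyz] : exists y, ~~ ole b y z.
    apply: contrapT => nex; apply: noend; exists z => y.
    by apply: contrapT => /negP yz; apply: nex; exists y.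
  exists (~` [set t | ole b y t]); last by exists y => t /negP/oleNge.
  apply: open_nbhs_nbhs; split; last exact/negP.
  apply: closed_openC; rewrite (_ : [set _ | _] = [set t | ole (~~ b) t y]).
    exact: closed_ole.
  by apply/seteqP; split=> t /=; rewrite oleN.
by exists y => z Az; apply/Vy/AV/subset_closure.
Qed.

(** If [m] bounds the ray, the later of [m] and [y] bounds the whole space. *)
Lemma ray_not_precompact b y : ~ (exists x, forall z, ole b z x) ->
  ~ precompact [set x | ~~ ole b x y].
Proof.
move=> noend pA; apply: noend; have [m mP] := precompact_bounded b y pA.
have [ym|/oleNge my] := boolP (ole b y m).
  exists m => z; have [zy|zy] := boolP (ole b z y); first exact: ole_trans ym.
  exact: mP.
by exists y => z; apply: contrapT => /negP zy; move: (zy);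
  rewrite (ole_trans (mP _ zy)).
Qed.

Lemma noncompact_end b : ~ compact [set: set_type D] ->
  (exists x, forall z, ole b x z) -> ~ (exists x, forall z, ole b z x).
Proof.
move=> nc [x xP] [y yP]; apply: nc; rewrite -(precompact_closed closedT).
by apply: (@precompact_segment b _ x y) => z _; rewrite xP yP.
Qed.

End subtypes_of_the_line.

(** * Noncompact q-spaces and solid sets in the line *)

(** Every neighbourhood of infinity contains the complement of a compact set and so meets [A]; thus
    [None] is in the closure of [A]. *)
Lemma opc_connected (X : topologicalType) (A : set X) :
  connected A -> ~ precompact A ->
  connected ((Some @` A : set (one_point_compactification X)) `|` [set None]).
Proof.
move=> cA npA; apply: connected_closureU; last exact: connected1.
  exists None; split=> // V [U [cU clU] UV].
  have [x [Ax nUx]] : exists x, A x /\ ~ U x.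
    apply: contrapT => nex; apply: npA; exists U => //= x Ax.
    by apply: contrapT => nUx; apply: nex; exists x.
  by exists (Some x); split; [exists x|apply: UV; left; exists x].
apply: connected_continuous_connected cA _; apply: continuous_subspaceT.
exact: one_point_compactification_some_continuous.
Qed.

(* An interval without endpoints compactifies to a circle, which is the union
   of two points and the two open arcs between them. *)
Lemma noncompact_qspace_end (R : realType) (D : set R) :
  noncompact_qspace (set_type D) ->
  exists b, exists x : set_type D, forall y, ole b x y.
Proof.
move=> [[nc _] hD cD _ g0]; apply: contrapT => noend.
have nend b : ~ exists x : set_type D, forall y, ole b y x.
  by move=> [x xP]; apply: noend; exists (~~ b), x => y; rewrite oleN.
have [p _] : [set: set_type D] !=set0.
  by apply: contrapT => /set0P/negP/negPn/eqP E0; apply: nc; rewrite E0; exact: compact0.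
have iD := set_type_interval cD.
pose opc := one_point_compactification (set_type D).
pose arc b := [set x : set_type D | ~~ ole b x p].
have copc : compact [set: opc] by exact: one_point_compactification_compact.
have arcn b : ~ precompact (arc b) by exact/ray_not_precompact/nend.
have arcC b : arc b `<=` ~` arc (~~ b).
  by move=> x /oleNge px; rewrite /arc /setC /= oleN px.
have carc b : connected (arc b).
  apply: (convex_connected iD (b := b)) => x y z /= xp _ xz _.
  by apply: contra xp; exact: ole_trans xz.
have carcC b : connected (~` arc b).
  apply: (convex_connected iD (b := b)) => x y z /= _ /negP/negPn yp _ zy.
  by apply/negP/negPn; exact: ole_trans yp.
have carcCo b : connected (Some @` (~` arc b) `|` [set None] : set opc).
  apply: opc_connected => //; apply: contra_not (arcn (~~ b)).
  by apply: precompact_subset; rewrite -{2}(negbK b); exact: arcC.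
have cSome (A : set (set_type D)) : connected A -> connected (Some @` A : set opc).
  move=> cA; apply: connected_continuous_connected cA _.
  apply: continuous_subspaceT; exact: one_point_compactification_some_continuous.
have oarc b : open (Some @` arc b : set opc).
  apply: one_point_compactification_open_some.
  rewrite (_ : arc b = ~` [set x | ole b x p]); first exact/closed_openC/closed_ole.
  by apply/seteqP; split=> x /= /negP.
have solidI (A : set opc) : connected A -> connected (~` A) -> solid A by split.
have arc_solid b : solid (Some @` arc b : set opc).
  apply: solidI; first exact: cSome.
  rewrite (_ : ~` _ = Some @` (~` arc b) `|` [set None]) //.
  apply/seteqP; split=> [[x|] /= nx|_ [[x nx <-]|->]]; [left|by right| |].
  - by exists x => // ax; apply: nx; exists x.
  - by move=> [y ay [yx]]; apply: nx; rewrite -yx.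
  - by case.
have None_solid : solid ([set None] : set opc).
  apply: solidI; first exact: connected1.
  rewrite (_ : ~` _ = Some @` [set: set_type D]); first exact: cSome.
  by apply/seteqP; split=> [[x|]//= _|_ [x _ <-]//]; exists x.
have p_solid : solid ([set Some p] : set opc).
  apply: solidI; first exact: connected1.
  (* The complement of [p] consists of the two arcs joined at infinity. *)
  rewrite (_ : ~` _ = (Some @` arc true `|` [set None]) `|`
    (Some @` arc false `|` [set None])).
    by apply: connectedU; [exists None; split; right|exact: opc_connected..].
  apply/seteqP; split=> [[x|] /= xp|].
  - have [xp1|] := boolP (ole true x p); last by left; left; exists x.
    right; left; exists x => //; apply/negP => xp2; apply: xp; congr Some.
    by apply: (@ole_anti _ _ true); rewrite xp1.
  - by left; right.
  - by move=> _ [[[x xp <-]|->]|[[x xp <-]|->]] //= [xp1]; move: xp; rewrite /arc /= xp1 lexx.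
have None_closed : closed ([set None] : set opc).
  rewrite -openC (_ : ~` _ = Some @` [set: set_type D]).
    by apply: one_point_compactification_open_some; exact: openT.
  by apply/seteqP; split=> [[x|]//= _|_ [x _ <-]//]; exists x.
have p_closed : closed ([set Some p] : set opc).
  rewrite -openC openE => -[x xp|_] /=.
    suff : nbhs x (~` [set p]) by apply: filterS => y yp [].
    apply: open_nbhs_nbhs; split; last by move=> xp'; apply: xp; rewrite xp'.
    by apply: closed_openC; apply: compact_closed => //; exact: compact_set1.
  exists [set p]; first by split; [exact: compact_set1|
    apply: compact_closed => //; exact: compact_set1].
  by move=> _ [[x xp <-] [xp']|->].
have arc0 b : (arc b) !=set0.
  apply: contrapT => arcE; apply: (nend b); exists p => x.
  by apply: contrapT => /negP xp; apply: arcE; exists x.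
(* Fibres of a labelling are disjoint and exhaustive at once: 0 for infinity, 1 for [p], 2 below and
   3 above [p]. *)
pose label (o : opc) : nat :=
  if o isn't Some x then 0%N
  else if x == p then 1%N else if ole true x p then 2%N else 3%N.
pose A (i : 'I_4) := [set o | label o = i].
have arcE b x : (~~ ole b x p) = (x != p) && ole (~~ b) x p.
  rewrite oleN; apply/idP/andP => [xp|[xNp px]].
    by split; [apply: contraNneq xp => ->; exact: ole_refl|exact: oleNge].
  by apply: contraNN xNp => xp; apply/eqP/(@ole_anti _ _ b); rewrite xp.
suff : (4 <= 2)%N by [].
apply: (g0 4 A) => [i|i j _ _ [u [ui uj]]|].
- suff : A i = [set None] \/ A i = [set Some p] \/ exists b, A i = Some @` arc b.
    move=> [->|[->|[b ->]]]; split=> //; [by exists None|by right|by exists (Some p)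
      |by right| |by left].
    by have [x xp] := arc0 b; exists (Some x), x.
  rewrite {}/A; case: i => -[|[|[|[|//]]]] i4.
  + left; apply/seteqP; split=> [[x|]|x ->] //=.
    by case: ifP => // _; case: ifP.
  + right; left; apply/seteqP; split=> [[x|]|x ->] //=; last by rewrite eqxx.
    by case: (eqVneq x p) => [->//|_]; case: ifP.
  + right; right; exists false; apply/seteqP; split=> [[x|]|_ [x + <-]] //=.
      by case: (eqVneq x p) => // xNp; case: ifP => // xp _; exists x => //;
        rewrite /arc /mkset arcE xNp.
    by rewrite /arc /mkset arcE => /andP[/negbTE -> /= ->].
  + right; right; exists true; apply/seteqP; split=> [[x|]|_ [x + <-]] //=.
      by case: (eqVneq x p) => // _; case: ifPn => // xp _; exists x.
    rewrite /arc /mkset => xp; have := xp.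
    by rewrite arcE => /andP[/negbTE -> _]; move: xp => /= /negbTE ->.
- exact/val_inj/(etrans (esym ui) uj).
- apply/seteqP; split=> // o _.
  have o4 : (label o < 4)%N by case: o => [x|] //=; case: ifP => // _; case: ifP.
  by exists (Ordinal o4).
Qed.

(** In the compact case [A] and its complement are both convex. In the noncompact case let [a] be
    the end: if [x] precedes a point [y] of [A] but is not in [A], the component of [x] in the
    complement stays between [a] and [y], so it is precompact. *)
Lemma solid_ordered (R : realType) (D : set R) (A : set (set_type D)) :
  qspace (set_type D) \/ noncompact_qspace (set_type D) -> solid A ->
  exists b, forall x y, A y -> ole b x y -> A x.
Proof.
move=> qD [cA cAC ncAC]; have [_ _ /(@set_type_interval _ _) iD _] := qspace_basics qD.
case: qD => [[cD _ _ _ _]|nqD].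
  have {}cAC := cAC cD.
  have [low|/existsNP[x /existsNP[y /not_implyP[Ay /not_implyP[xy nAx]]]]] :=
    pselect (forall x y, A y -> ole true x y -> A x); first by exists true.
  exists false => u v Av vu; apply: contrapT => nAu.
  (* Now [x] precedes [y] and [v] precedes [u], with only [y] and [v] in [A]. The side of [y] on
     which [u] lies decides whether [A] or its complement fails to be convex. *)
  have [uy|/oleNge yu] := boolP (ole true u y).
    exact: nAu (connected_convex (b := true) cA Av Ay vu uy).
  exact: (connected_convex (b := true) cAC nAx nAu xy yu).
have [[ncD _] _ _ _ _] := nqD; have [b [a amin]] := noncompact_qspace_end nqD.
exists b => x y Ay xy; apply: contrapT => nAx.
apply: (ncAC ncD x nAx); apply: (precompact_segment iD (b := b) (x := a) (y := y)).
move=> z xz; rewrite amin /=; apply: contrapT => /negP/oleNge yz.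
have /connected_component_sub : connected_component (~` A) x y; last exact.
apply: (connected_convex (b := b) (@component_connected _ _ _) _ xz xy yz).
exact: connected_component_refl.
Qed.

(** In the noncompact case the rays contain the endpoint. The complement of a ray is connected, so
    it is its only component, and it runs off in the direction without end. *)
Lemma solid_rays (R : realType) (D : set R) :
  qspace (set_type D) \/ noncompact_qspace (set_type D) ->
  exists b, forall c : set_type D, solid [set x | ole b x c].
Proof.
move=> qD; have [_ _ /(@set_type_interval _ _) iD _] := qspace_basics qD.
have ray b c : connected [set x : set_type D | ole b x c].
  by apply: (convex_connected iD (b := b)) => x y z _ yc _ zy; exact: ole_trans yc.
have rayC b c : connected (~` [set x : set_type D | ole b x c]).
  apply: (convex_connected iD (b := b)) => x y z /= xc _ xz _.
  by apply: contra_not xc; exact: ole_trans xz.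
case: qD => [[cD _ _ _ _]|nqD]; first by exists true => c; split.
have [[ncD _] _ _ _ _] := nqD; have [b minb] := noncompact_qspace_end nqD.
exists b => c; split=> // _ x xc; rewrite connected_component_id //.
rewrite (_ : ~` _ = [set x | ~~ ole b x c]).
  exact/ray_not_precompact/noncompact_end.
by apply/seteqP; split=> z /negP.
Qed.

(** * Monotone maps and the sample median *)

(** Otherwise [f] falls from [x] to some later [y] and rises from [u] to some later [v]. The
    sublevel set at [f y] is then an upper set and the one at [f u] a lower set. *)
Lemma ordered_fibers_monotone (R : realType) (D1 D2 : set R)
    (f : set_type D1 -> set_type D2) (b : bool) :
  (forall c, exists b', forall x y, ole b (f y) c -> ole b' x y -> ole b (f x) c) ->
  exists b', forall x y, ole b' x y -> ole b (f x) (f y).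
Proof.
move=> fib.
have [inc|/existsNP[x /existsNP[y /not_implyP[xy /negP fyx]]]] :=
  pselect (forall x y, ole true x y -> ole b (f x) (f y)); first by exists true.
have [dec|/existsNP[v /existsNP[u /not_implyP[uv /negP fuv]]]] :=
  pselect (forall x y, ole false x y -> ole b (f x) (f y)); first by exists false.
exfalso.
have up : forall s t, ole b (f t) (f y) -> ole true t s -> ole b (f s) (f y).
  have [[] P] := fib (f y); last exact: P.
  by move: fyx; rewrite (P x y) ?ole_refl.
have down : forall s t, ole b (f t) (f u) -> ole true s t -> ole b (f s) (f u).
  have [[] P] := fib (f u); first exact: P.
  by move: fuv; rewrite (P v u) ?ole_refl.
(* If [f u] is at most [f y], the upper set forces [x] before [u], and the lower set then puts [f x]
   at most [f u]. The other case is symmetric. *)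
have /orP[uy|yu] := ole_total b (f u) (f y).
  have ux : ~~ ole true u x by apply: contraNN fyx; exact: up.
  have fxu : ole b (f x) (f u).
    by apply: (down x u); [exact: ole_refl|exact: oleNge].
  by move: fyx; rewrite (ole_trans fxu).
have vy : ~~ ole true v y by apply: contraNN fuv; exact: down.
have fvy : ole b (f v) (f y).
  by apply: (up v y); [exact: ole_refl|exact: oleNge].
by move: fuv; rewrite (ole_trans fvy).
Qed.

(** Preimages of the closed solid rays are solid, hence initial or final segments. *)
Lemma solid_variable_monotone (R : realType) (D1 D2 : set R)
    (f : set_type D1 -> set_type D2) :
  qspace (set_type D1) \/ noncompact_qspace (set_type D1) ->
  qspace (set_type D2) \/ noncompact_qspace (set_type D2) ->
  solid_variable f -> exists b, {homo f : x y / ole true x y >-> ole b x y}.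
Proof.
move=> q1 q2 [_ sf]; have [b rayP] := solid_rays q2.
have [c|b' fP] := @ordered_fibers_monotone R D1 D2 f b.
  have [b' bP] : exists b', forall x y, ole b (f y) c -> ole b' x y -> ole b (f x) c.
    apply: (solid_ordered q1 (A := f @^-1` [set x | ole b x c])).
    by apply: sf => //; right; exact: closed_ole.
  by exists b'.
case: b' fP => fP; first by exists b.
by exists (~~ b) => x y xy; rewrite oleN; exact: fP.
Qed.

(** An order-reversing [f] reverses the sorted list, and reversal fixes the middle position of a
    list of odd length. *)
Lemma order_statistic_monotone (R : realType) (D1 D2 : set R) (Y : Type)
    (n : nat) (T : 'I_(n.*2.+1) -> Y -> set_type D1)
    (f : set_type D1 -> set_type D2) (b : bool) (y : Y) :
  {homo f : u v / ole true u v >-> ole b u v} ->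
  order_statistic n.+1 (fun i => f \o T i) y = f (order_statistic n.+1 T y).
Proof.
move=> fP; rewrite /order_statistic; set s := [seq T i y | i <- _].
have -> : [seq (f \o T i) y | i <- enum 'I_n.*2.+1] = map f s by rewrite /s -map_comp.
have sz : size s = n.*2.+1 by rewrite size_map size_enum_ord.
have ns : (n < size s)%N by rewrite sz ltnS -addnn leq_addr.
(* [ole true] unfolds to the order in [order_statistic], and rank [n.+1] is position [n], counted
   from 0. *)
change (nth (f (T ord0 y)) (sort (ole true) (map f s)) n =
  f (nth (T ord0 y) (sort (ole true) s) n)).
move: (T ord0 y) => d.
have sorts : sorted (ole true) (sort (ole true) s).
  by apply: sort_sorted; exact: ole_total.
have sort_map : sort (ole true) (map f s) =
    if b then map f (sort (ole true) s) else rev (map f (sort (ole true) s)).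
  apply: (sorted_eq (@ole_trans _ _ true) (@ole_anti _ _ true)).
  - by apply: sort_sorted; exact: ole_total.
  - case: b fP => fP; first exact: homo_sorted sorts.
    by rewrite rev_sorted; exact: homo_sorted sorts.
  - rewrite perm_sort; case: b {fP}.
      by apply: perm_map; rewrite perm_sym perm_sort.
    by rewrite perm_sym perm_rev; apply: perm_map; rewrite perm_sort.
rewrite sort_map; have nsort : (n < size (sort (ole true) s))%N by rewrite size_sort.
case: b {fP sort_map}; first by rewrite (nth_map d).
(* Position [n] of the reversed list is position [2n+1-(n+1) = n] of the list. *)
rewrite nth_rev size_map size_sort // sz subSS -addnn addnK.
by rewrite (nth_map d).
Qed.

(* In the first part the 2n - 1 maps, n >= 1, are indexed by 'I_(n'.*2.+1),
   with n = n'.+1, and X_1, X_2 are subsets of R with the induced topology. *)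
Theorem theorem83 (R : realType) :
  (forall (D1 D2 : set R) (Y : topologicalType) (n : nat)
      (T : 'I_(n.*2.+1) -> Y -> set_type D1)
      (f : set_type D1 -> set_type D2),
    qspace (set_type D1) \/ noncompact_qspace (set_type D1) ->
    qspace (set_type D2) \/ noncompact_qspace (set_type D2) ->
    hausdorff_space Y -> locally_compact [set: Y] ->
    (forall i, continuous (T i) /\ proper_map (T i)) ->
    solid_variable f -> proper_map f ->
    forall A : set (set_type D2),
      order_statistic n.+1 T @^-1` (f @^-1` A) =
      order_statistic n.+1 (fun i => f \o T i) @^-1` A)
  /\
  (forall (X1 X2 Y : topologicalType) (m : nat)
      (T : 'I_m -> Y -> X1) (f : X1 -> X2) (P : set Y -> \bar R),
    qspace X1 \/ noncompact_qspace X1 ->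
    qspace X2 \/ noncompact_qspace X2 ->
    hausdorff_space Y -> locally_compact [set: Y] ->
    (0 < m)%N ->
    (forall i, continuous (T i) /\ proper_map (T i)) ->
    solid_variable f -> proper_map f ->
    deficient_topological_measure P ->
    forall mu : set X1 -> \bar R, is_gdsm P T mu ->
    forall nu : set X2 -> \bar R,
      is_gdsm P (fun i => f \o T i) nu <->
      (forall A : set X2, open_or_compact A -> nu A = mu (f @^-1` A))).
Proof.
split=> [D1 D2 Y n T f q1 q2 _ _ _ sf _ A|X1 X2 Y m T f P q1 q2 _ _ _ _ sf pf _ mu muP nu].
  have [b fP] := solid_variable_monotone q1 q2 sf.
  by apply/seteqP; split=> y; rewrite /preimage /= (order_statistic_monotone _ _ fP).
exact: gdsm_equivariant.
Qed.
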